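(* For any integer $t \ge 3$, $N(2,2,t)\ge 2t+6$.
   Context: For a finite set $X\subset\mathbb{R}^d$, $\mathrm{conv}(X)$ denotes its convex hull (with $\mathrm{conv}(\emptyset)=\emptyset$). For a positive integer $t$, a partition of a finite set $P\subset\mathbb{R}^d$ into $k$ pairwise disjoint subsets $P_1,\dots,P_k$ with union $P$ is called $t$-tolerant if for every set $Y\subset P$ of at most $t$ points, $\bigcap_{i=1}^k \mathrm{conv}(P_i\setminus Y)\neq\emptyset$. For positive integers $d,k,t$, $N(d,k,t)$ denotes the smallest positive integer $N$ such that every set $P$ of $N$ (distinct) points in $\mathbb{R}^d$ can be partitioned into $k$ subsets $P_1,\dots,P_k$ forming a $t$-tolerant partition. (Such an integer always exists.) *)

(* Defs.v *)
From HB Require Import structures.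
From mathcomp Require Import all_boot all_order all_algebra finmap.
From mathcomp Require Import boolp classical_sets reals convex.

Set Implicit Arguments.
Unset Strict Implicit.
Unset Printing Implicit Defensive.

Local Open Scope classical_set_scope.
Local Open Scope fset_scope.
Local Open Scope nat_scope.

Section Tolerance.
Variables (R : realType) (d : nat).
Implicit Types (X P Y : {fset 'rV[R]_d}) (t k n : nat).

Definition conv X : set 'rV[R]_d :=
  smallest (@convex_set R 'rV[R]_d) [set` X].

(* The parts may be empty. *)
Definition is_partition P k (Q : 'I_k -> {fset 'rV[R]_d}) : Prop :=
  (forall i j, i != j -> [disjoint Q i & Q j]%fset) /\
  \big[fsetU/fset0]_(i < k) Q i = P.

Definition tolerant t P k (Q : 'I_k -> {fset 'rV[R]_d}) : Prop :=
  forall Y, (Y `<=` P)%fset -> #|` Y| <= t ->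
    \bigcap_(i : 'I_k) conv (Q i `\` Y)%fset !=set0.

Definition always_tolerant k t n : Prop :=
  forall P, #|` P| = n ->
    exists Q : 'I_k -> {fset 'rV[R]_d}, is_partition P Q /\ tolerant t P Q.

End Tolerance.

(* The least positive n such that always_tolerant R d k t n holds; the value
   would be 0 if there were no such n, so that a positive lower bound also
   entails existence. *)
Definition tolerance_number (R : realType) (d k t : nat) : nat :=
  if pselect (exists n, `[< 0 < n /\ always_tolerant R d k t n >]) is left ex
  then ex_minn ex else 0.

(* Main.v *)
(* Lower bound: a 2-colouring is not t-tolerant as soon as some line has at most
   t points on the wrong side. Take ten fixed points and m = 2t - 5 points far
   out on a horizontal ray, which lies on the positive side of each of thirteen
   fixed lines. A finite check shows that, for every colouring of the ten points,
   some line g misplaces at least four more of them than another line f. If r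
   and s points of the ray have the two colours, then f with one orientation and
   g with the other misplace a + s and (10 - b) + r points, where b >= a + 4;
   these numbers add up to at most 6 + m = 2t + 1, so one of them is at most t.
   Finiteness: among (d + 2)(t + 1) points there are t + 1 disjoint Radon
   partitions, and their union survives the removal of any t points. *)
From mathcomp Require Import all_boot all_order all_algebra finmap zify lra.
From mathcomp Require Import boolp classical_sets interval_inference reals convex.
Require Import Defs.

Set Implicit Arguments.
Unset Strict Implicit.
Unset Printing Implicit Defensive.

Import Order.TTheory GRing.Theory Num.Theory.

Local Open Scope classical_set_scope.
Local Open Scope fset_scope.
Local Open Scope ring_scope.

(** * Convex hulls, Radon partitions and finiteness of the tolerance number *)

Section Convexity.
Variables (R : realType) (d : nat).
Implicit Types (X Y A B S P : {fset 'rV[R]_d}) (t : nat).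

Lemma convex_conv X : @convex_set R 'rV[R]_d (conv X).
Proof.
move=> x y l /set_mem xX /set_mem yX; apply/mem_set => C [cC XC].
by apply/set_mem/cC; apply/mem_set; [exact: xX|exact: yX].
Qed.

Lemma sub_conv X x : x \in X -> conv X x.
Proof. by move=> xX C [_]; apply. Qed.

Lemma convS X Y : X `<=` Y -> (conv X `<=` conv Y)%classic.
Proof.
move=> /fsubsetP XY; apply: sub_smallest2r; first exact: convex_conv.
by move=> x; exact: XY.
Qed.

Lemma conv_sum (I : finType) (p : pred I) (w : I -> R) (x : I -> 'rV[R]_d) X :
    (forall i, p i -> 0 < w i) -> (forall i, p i -> x i \in X) ->
    0 < \sum_(i | p i) w i ->
  conv X ((\sum_(i | p i) w i)^-1 *: \sum_(i | p i) w i *: x i).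
Proof.
move=> w0 xX.
(* The invariant for building the sum term by term: the first alternative is the empty sum, where
   dividing by [s] would be meaningless. *)
suff [[-> _]|[]//] : let s := \sum_(i | p i) w i in
    let v := \sum_(i | p i) w i *: x i in
    (s = 0 /\ v = 0) \/ (0 < s /\ conv X (s^-1 *: v)) by rewrite ltxx.
apply: (big_ind2 (fun (s : R) (v : 'rV[R]_d) =>
    (s = 0 /\ v = 0) \/ (0 < s /\ conv X (s^-1 *: v)))); first by left.
- move=> a u b v [[-> ->]|[a0 au]]; first by rewrite !add0r.
  move=> [[-> ->]|[b0 bv]]; first by rewrite !addr0; right.
  right; have ab0 : 0 < a + b by rewrite addr_gt0.
  split => //.
  have l0 : 0 <= a / (a + b) by rewrite divr_ge0 ?ltW.
  have l1 : a / (a + b) <= 1 by rewrite ler_pdivrMr// mul1r lerDl ltW.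
  have := convex_conv (Itv01 l0 l1) (mem_set au) (mem_set bv).
  move=> /set_mem; congr (conv X _).
  rewrite /convex.conv/= /unstable.onem scalerDr !scalerA.
  have ne : a + b != 0 by rewrite gt_eqF.
  congr (_ *: _ + _ *: _).
    by rewrite mulrAC divff ?mul1r// gt_eqF.
  rewrite -{1}(divff ne) -mulrBl addrAC subrr add0r.
  by rewrite mulrAC divff ?mul1r// gt_eqF.
- move=> i pi; right; split; first exact: w0.
  by rewrite scalerA mulVf ?gt_eqF ?w0// scale1r; exact: sub_conv (xX _ pi).
Qed.

(** An affine dependence among the points is split by the sign of its coefficients; both halves,
    once normalised, represent the same point. *)
Lemma radon S : #|` S| = d.+2 ->
  exists A B, [/\ [disjoint A & B]%fset, A `|` B = S
                & conv A `&` conv B !=set0].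
Proof.
move=> cS.
pose x (i : 'I_d.+2) : 'rV[R]_d := nth 0 S i.
have x_inj : injective x.
  move=> i j /eqP; rewrite nth_uniq ?cS ?fset_uniq// => /eqP; exact: val_inj.
have xS i : x i \in S by rewrite mem_nth// cS.
have Sx y : y \in S -> exists i, y = x i.
  move=> yS; have yi : (index y S < d.+2)%N by rewrite -cS index_mem.
  by exists (Ordinal yi); rewrite /x nth_index.
(* With a coordinate 1 appended, d + 2 rows live in dimension d + 1, so the left kernel is nonzero;
   the extra column forces the coefficients to sum to 0. *)
pose M : 'M[R]_(d.+2, d + 1) := row_mx (\matrix_i x i) (const_mx 1).
have : kermx M != 0.
  rewrite kermx_eq0 /row_free; apply/eqP => rM.
  by have := rank_leq_col M; rewrite rM addn1 ltnn.
move=> /rowV0Pn [l /sub_kermxP lM l0].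
move: lM; rewrite mul_mx_row -row_mx0 => /eq_row_mx [lx l1].
have sl : \sum_i l 0 i = 0.
  have /matrixP/(_ 0 0) := l1; rewrite !mxE => l1E; rewrite -[RHS]l1E.
  by apply: eq_bigr => i _; rewrite !mxE mulr1.
have slx : \sum_i l 0 i *: x i = 0.
  by rewrite -[RHS]lx mulmx_sum_row; apply: eq_bigr => i _; rewrite rowK.
pose A := [fset x i | i in 'I_d.+2 & 0 < l 0 i].
pose s := \sum_(i | 0 < l 0 i) l 0 i.
pose v := \sum_(i | 0 < l 0 i) l 0 i *: x i.
have sN : \sum_(i | l 0 i < 0) - l 0 i = s.
  rewrite sumrN; apply/eqP; rewrite eq_sym -addr_eq0; apply/eqP.
  rewrite -[RHS]sl [RHS](bigID (fun i => 0 < l 0 i))/=; congr (_ + _).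
  rewrite [RHS](bigID (fun i => l 0 i == 0))/= [X in _ = X + _]big1 ?add0r; last first.
    by move=> j /andP[_ /eqP].
  by apply: eq_bigl => i; rewrite -leNgt lt_neqAle andbC.
have vN : \sum_(i | l 0 i < 0) (- l 0 i) *: x i = v.
  under eq_bigr do rewrite scaleNr.
  rewrite sumrN; apply/eqP; rewrite eq_sym -addr_eq0; apply/eqP.
  rewrite -[RHS]slx [RHS](bigID (fun i => 0 < l 0 i))/=; congr (_ + _).
  rewrite [RHS](bigID (fun i => l 0 i == 0))/= [X in _ = X + _]big1 ?add0r; last first.
    by move=> j /andP[_ /eqP ->]; rewrite scale0r.
  by apply: eq_bigl => i; rewrite -leNgt lt_neqAle andbC.
(* If [s] were 0, all positive coefficients would vanish, and by [sN] all negative ones too, against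
   [l0]. *)
have s0 : 0 < s.
  rewrite lt_neqAle sumr_ge0 ?andbT; last by move=> i /ltW.
  apply: contra l0; rewrite eq_sym => /eqP s0; apply/eqP/rowP => i.
  rewrite mxE; have [li|li|//] := ltgtP (l 0 i) 0.
  - have /psumr_eq0P/(_ i li) : \sum_(i | l 0 i < 0) - l 0 i = 0.
      by rewrite sN.
    move=> /(_ _)/eqP; rewrite oppr_eq0 => /(_ _)/eqP; apply.
    by move=> j /ltW; rewrite oppr_ge0.
  - by have /psumr_eq0P/(_ i li) := s0; apply => j /ltW.
(* Points with zero coefficient join the negative side, where they only enlarge the hull. *)
exists A, (S `\` A); split.
- by apply/fdisjointP => y yA; rewrite inE yA.
- apply/fsetP => y; rewrite !inE; case: (boolP (y \in A)) => //=.
  by move=> /imfsetP[i _ ->]; rewrite xS.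
exists (s^-1 *: v); split.
  by apply: conv_sum => // i li; apply/imfsetP; exists i => //=; rewrite inE.
rewrite -sN -vN; apply: conv_sum => [i|i li|]; rewrite ?oppr_gt0 ?sN//.
rewrite inE xS andbT; apply/imfsetP => -[j /=]; rewrite inE => lj /x_inj ij.
by move: li; rewrite ij ltNge ltW.
Qed.

(** Induction on [t]: split off d + 2 points [S] with a Radon partition. If [Y] misses [S], that
    partition is intact; otherwise at most [t] points of [Y] lie outside [S], and induction handles
    the rest. *)
Lemma tolerant_radon t P : #|` P| = (d.+2 * t.+1)%N ->
  exists A B, [/\ [disjoint A & B]%fset, A `|` B = P
    & forall Y, (#|` Y| <= t)%N -> conv (A `\` Y) `&` conv (B `\` Y) !=set0].
Proof.
elim: t P => [|t IH] P.
  rewrite muln1 => /radon [A [B [dAB AB ne]]]; exists A, B; split => // Y.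
  by rewrite leqn0 cardfs_eq0 => /eqP ->; rewrite !fsetD0.
move=> cP.
have [S SP cS] : exists2 S, S `<=` P & #|` S| = d.+2.
  exists [fset x in take d.+2 P].
    by apply/fsubsetP => x; rewrite inE => /mem_take.
  by rewrite card_fseq undup_id ?take_uniq// size_takel// cP mulnS leq_addr.
have cPS : #|` P `\` S| = (d.+2 * t.+1)%N by rewrite cardfsDS// cP cS; lia.
have [A0 [B0 [dAB0 AB0 ne0]]] := radon cS.
have [A1 [B1 [dAB1 AB1 ne1]]] := IH _ cPS.
have memS x : (x \in S) = (x \in A0) || (x \in B0) by rewrite -AB0 inE.
have memP x : (x \notin S) && (x \in P) = (x \in A1) || (x \in B1).
  by rewrite -in_fsetD -AB1 inE.
exists (A0 `|` A1), (B0 `|` B1); split.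
- apply/fdisjointP => x; rewrite !inE => /orP[] xA; apply/negP => /orP[] xB.
  + by have /fdisjointP/(_ _ xA) := dAB0; rewrite xB.
  + by have := memP x; rewrite memS xA xB orbT.
  + by have := memP x; rewrite memS xA xB orbT.
  + by have /fdisjointP/(_ _ xA) := dAB1; rewrite xB.
- by rewrite fsetUACA AB0 AB1 fsetUDl fsetDv fsetD0; apply/fsetUidPr.
move=> Y cY.
have sub (C C' Z Z' : {fset 'rV[R]_d}) : (C `<=` C')%fset ->
    (C `&` Z' `<=` Z)%fset -> forall z, conv (C `\` Z) z -> conv (C' `\` Z') z.
  move=> /fsubsetP CC /fsubsetP CZ; apply: convS; apply/fsubsetP => x.
  rewrite !inE => /andP[xZ xC]; rewrite CC// andbT.
  by apply: contra xZ => xZ'; apply: CZ; rewrite inE xC.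
have [YS0|/fset0Pn[y]] := eqVneq (Y `&` S) fset0.
  have [z [zA zB]] := ne0; exists z.
  have YS x : x \in S -> x \notin Y.
    move=> xS; apply/negP => xY.
    have : x \in Y `&` S by rewrite inE xY.
    by rewrite YS0.
  split.
    rewrite -[A0]fsetD0 in zA; apply: sub zA; first exact: fsubsetUl.
    apply/fsubsetP => x; rewrite inE => /andP[xA xY].
    by have := YS x; rewrite memS xA xY => /(_ isT).
  rewrite -[B0]fsetD0 in zB; apply: sub zB; first exact: fsubsetUl.
  apply/fsubsetP => x; rewrite inE => /andP[xB xY].
  by have := YS x; rewrite memS xB xY orbT => /(_ isT).
rewrite inE => /andP[yY yS].
have : (#|` Y `\` S| <= t)%N.
  have := cardfsID S Y.
  have : (0 < #|` Y `&` S|)%N.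
    by rewrite cardfs_gt0; apply/fset0Pn; exists y; rewrite inE yY.
  lia.
move=> /ne1 [z [zA zB]]; exists z; split.
  apply: sub zA; first exact: fsubsetUr.
  apply/fsubsetP => x; rewrite !inE => /andP[xA ->]; rewrite andbT.
  by have := memP x; rewrite xA => /= /andP[].
apply: sub zB; first exact: fsubsetUr.
apply/fsubsetP => x; rewrite !inE => /andP[xB ->]; rewrite andbT.
by have := memP x; rewrite xB orbT => /= /andP[].
Qed.

Lemma always_tolerant_radon t : always_tolerant R d 2 t (d.+2 * t.+1).
Proof.
move=> P /tolerant_radon [A [B [dAB AB ne]]].
exists (fun i => if i == ord0 then A else B); split; [split|].
- move=> i j; case: (unliftP ord0 i) (unliftP ord0 j) => [i'|] -> [j'|] ->//=.
  + by rewrite (ord1 i') (ord1 j') eqxx.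
  + by move=> _; rewrite fdisjoint_sym.
- by rewrite big_ord_recl big_ord1.
move=> Y _ /ne [z [zA zB]]; exists z => i _ /=.
by case: ifP.
Qed.

(** The extra point is thrown into the first part, which can only enlarge a hull; [k.+1] guarantees
    that a first part exists. *)
Lemma always_tolerantS k t n :
  always_tolerant R d k.+1 t n -> always_tolerant R d k.+1 t n.+1.
Proof.
move=> tol P cP.
have /fset0Pn[p pP] : P != fset0 by rewrite -cardfs_gt0 cP.
have cPp : #|` P `\ p| = n by have := cardfsD1 p P; rewrite pP cP; lia.
have [Q [[dQ QP] tQ]] := tol _ cPp.
have QsP i : Q i `<=` P `\ p.
  by rewrite -QP; apply: bigfcup_sup => //; rewrite mem_index_enum.
have pQ i : p \notin Q i.
  by apply/negP => /(fsubsetP (QsP i)); rewrite !inE eqxx.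
exists (fun i => if i == ord0 then p |` Q i else Q i); split; [split|].
- move=> i j ij; have := dQ _ _ ij; move: ij.
  case: (eqVneq i ord0) => [->|_]; case: (eqVneq j ord0) => [->|_] // _ dij.
  + by rewrite fdisjointU1X pQ.
  + by rewrite fdisjoint_sym fdisjointU1X pQ fdisjoint_sym.
- rewrite big_ord_recl/= -fsetUA; rewrite big_ord_recl in QP.
  by rewrite QP fsetD1K.
move=> Y YP cY.
have YpP : Y `\ p `<=` P `\ p by apply: fsetDSS.
have cYp : (#|` Y `\ p| <= t)%N.
  by apply: leq_trans cY; apply/fsubset_leq_card/fsubD1set.
have [z zQ] := tQ _ YpP cYp; exists z => i _; apply: convS (zQ i I).
apply/fsubsetP => x; rewrite !inE negb_and negbK => /andP[] /orP[/eqP ->|xY] xQ.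
  by rewrite (negPf (pQ i)) in xQ.
by rewrite xY; case: ifP => _; rewrite ?inE xQ ?orbT.
Qed.

End Convexity.

Lemma always_tolerant_leq (R : realType) d k t m n : (m <= n)%N ->
  always_tolerant R d k.+1 t m -> always_tolerant R d k.+1 t n.
Proof.
move=> /subnK <-; elim: (n - m)%N => // j IH /IH.
by rewrite addSn; exact: always_tolerantS.
Qed.

(** * Separation by lines with integer coefficients *)

Lemma conv_gt (R : realType) d (X : {fset 'rV[R]_d}) (u : 'cV[R]_d) (c : R) :
    (forall x, x \in X -> c < (x *m u) 0 0) ->
  forall x, conv X x -> c < (x *m u) 0 0.
Proof.
move=> Xc; apply: smallest_sub => [|//].
apply/convex_setW => x y /set_mem/= xc /set_mem/= yc l l0 l1.
apply/mem_set => /=.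
have -> : (convex.conv l x y *m u) 0 0 =
    l%:num * (x *m u) 0 0 + (1 - l%:num) * (y *m u) 0 0.
  by rewrite mulmxDl -!scalemxAl [LHS]mxE; congr (_ + _); rewrite [LHS]mxE.
by nra.
Qed.

Section IntegerPoints.
Variable R : realType.
Implicit Types (f : int * int * int) (z : int * int).

Definition pt z : 'rV[R]_2 := \row_i (if i == ord0 then z.1 else z.2)%:~R.

(** A triple [(a, b, c)] encodes the line a x + b y + c = 0; over the integers, signs can be
    computed. *)
Definition aff f z : int := f.1.1 * z.1 + f.1.2 * z.2 + f.2.

Lemma pt_inj : injective pt.
Proof.
move=> [x y] [x' y'] /rowP e; move: (e ord0) (e ord_max).
by rewrite !mxE/= => /intr_inj -> /intr_inj ->.
Qed.

Lemma pt_aff f z : (pt z *m \col_i (if i == ord0 then f.1.1 else f.1.2)%:~R) 0 0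
  = (aff f z)%:~R - f.2%:~R.
Proof.
rewrite !mxE big_ord_recl big_ord1 !mxE/= /aff !rmorphD/= !rmorphM/=.
by rewrite addrK ![z.1%:~R * _]mulrC ![z.2%:~R * _]mulrC.
Qed.

(* The boolean [c] selects which part should lie on the positive side. *)
Lemma tolerant_misclassified t (zs : seq (int * int)) (Q : 'I_2 -> {fset 'rV[R]_2})
    f (c : bool) (P := [fset x in [seq pt z | z <- zs]]) :
    is_partition P Q -> tolerant t P Q -> (forall z, z \in zs -> aff f z != 0) ->
  (t < count (fun z => (pt z \in Q ord0) (+) (0 < aff f z)%R (+) c) zs)%N.
Proof.
move=> [dQ QP] tQ f0; rewrite ltnNge; apply/negP => le_t.
pose mis z := (pt z \in Q ord0) (+) (0 < aff f z) (+) c.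
(* Deleting the misplaced points leaves the two parts strictly on opposite sides of the line, so
   their hulls cannot meet. *)
pose Y := [fset x in [seq pt z | z <- zs & mis z]].
have YP : Y `<=` P.
  apply/fsubsetP => x; rewrite !inE => /mapP[z]; rewrite mem_filter => /andP[_ zzs] ->.
  exact: map_f.
have cY : (#|` Y| <= t)%N.
  by rewrite card_fseq (leq_trans (size_undup _))// size_map size_filter.
have [x xQ] := tQ _ YP cY.
have side i y : y \in Q i `\` Y ->
    exists2 z, y = pt z & aff f z != 0 /\ (0 < aff f z) = (i == ord0) (+) c.
  rewrite in_fsetD => /andP[yY yQ].
  have : y \in P.
    by rewrite -QP; apply/bigfcupP; exists i; rewrite ?mem_index_enum.
  rewrite inE => /mapP[z zzs yz]; exists z => //; split; first exact: f0.
  have -> : (i == ord0) = (y \in Q ord0).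
    have [<-|i0] := eqVneq i ord0; first by rewrite yQ.
    by have /fdisjointP/(_ _ yQ)/negPf-> := dQ _ _ i0.
  have : ~~ mis z.
    apply: contra yY => mz; rewrite inE yz; apply: map_f.
    by rewrite mem_filter mz.
  by rewrite /mis yz; case: (_ \in _); case: (0 < _); case: (c).
pose u : 'cV[R]_2 := \col_i (if i == ord0 then f.1.1 else f.1.2)%:~R.
have pos (i : 'I_2) : (i == ord0) (+) c -> - f.2%:~R < (x *m u) 0 0.
  move=> ic; apply: conv_gt (xQ i I) => y /side[z -> [_ sz]].
  by rewrite pt_aff ltrDr ltr0z sz ic.
have neg (i : 'I_2) : ~~ ((i == ord0) (+) c) -> (x *m u) 0 0 < - f.2%:~R.
  move=> ic; have -> : u = - - u by rewrite opprK.
  rewrite mulmxN mxE ltrN2; apply: conv_gt (xQ i I) => y /side[z -> [z0 sz]].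
  rewrite mulmxN mxE pt_aff opprB ltrDl oppr_gt0 ltrz0 lt_neqAle z0 leNgt sz.
  exact: ic.
have := lt_trans (pos (if c then ord_max else ord0) _)
  (neg (if c then ord0 else ord_max) _).
by rewrite ltxx => bot; suff : false by []; apply: bot; case: (c).
Qed.

End IntegerPoints.

(** * The configuration and its finite check *)

(* These points and the lines below were found by computer search. *)
Definition base : seq (int * int) :=
  [:: (0, 5%Z); (0, -5%Z); (2%Z, 9%Z); (2%Z, -9%Z); (3%Z, 8%Z); (3%Z, -8%Z);
      (4%Z, 6%Z); (4%Z, -6%Z); (8%Z, 4%Z); (8%Z, -4%Z)].

(** 50 is the first integer abscissa on the horizontal axis from which all the forms in [lines] are
    positive. *)
Definition ray m : seq (int * int) := [seq (Posz (50 + j)%N, 0) | j <- iota 0 m].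

Definition lines : seq (int * int * int) :=
  [:: (0, 2%Z, 11%Z); (1, 0, -1%Z); (2%Z, -1%Z, -6%Z);
      (1, 10%Z, -49%Z); (1, -10%Z, -49%Z); (1, 3%Z, -21%Z); (1, -3%Z, -21%Z);
      (6%Z, 4%Z, -49%Z); (6%Z, -4%Z, -49%Z); (10%Z, 12%Z, -127%Z);
      (10%Z, -12%Z, -127%Z); (12%Z, 5%Z, -77%Z); (12%Z, -5%Z, -77%Z)].

Definition sides f := [seq 0 < aff f z | z <- base].

Definition hamming (a b : seq bool) := count (fun p => p.1 (+) p.2) (zip a b).

(** Quantification over all words of length [n] as a boolean, so that the 1024 colourings can be
    checked by evaluation. *)
Fixpoint all_bits n (p : seq bool -> bool) :=
  if n is n'.+1 then
    all_bits n' (fun b => p (true :: b)) && all_bits n' (fun b => p (false :: b))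
  else p [::].

Lemma all_bitsP n p : all_bits n p -> forall b, size b = n -> p b.
Proof.
elim: n p => [|n IH] p /=; first by move=> p0 [].
by move=> /andP[p1 p0] [//|[] b] [sb]; [exact: IH p1 b sb|exact: IH p0 b sb].
Qed.

Lemma lines_discrepancy (b : seq bool) : size b = 10 ->
  exists f g, [/\ f \in lines, g \in lines
                & (hamming b (sides f) + 4 <= hamming b (sides g))%N].
Proof.
pose p ss b := has (fun s => has (fun s' => hamming b s + 4 <= hamming b s')%N ss) ss.
have /all_bitsP H : (let ss := [seq sides f | f <- lines] in all_bits 10 (p ss)).
  by vm_compute.
move=> /H /hasP[_ /mapP[f fl ->] /hasP[_ /mapP[g gl ->] fg]].
by exists f, g.
Qed.

(** * The counterexample and the lower bound *)

Lemma not_always_tolerant (R : realType) t : (3 <= t)%N ->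
  ~ always_tolerant R 2 2 t (2 * t + 5).
Proof.
move=> t3 tol; pose m := (2 * t - 5)%N.
(* Since [t] is at least 3, the truncated subtraction is exact. *)
have mE : (m + 5 = 2 * t)%N by rewrite /m; lia.
pose zs := base ++ ray m.
have uzs : uniq zs.
  rewrite cat_uniq; apply/and3P; split; first by vm_compute.
    have /allP lt50 : all (fun z => z.1 < 50%Z) base by vm_compute.
    by apply/hasPn => _ /mapP[j _ ->]; apply/negP => /lt50/=; lia.
  by rewrite map_inj_uniq ?iota_uniq// => i j [/addnI].
have [|Q [QP tQ]] := tol [fset x in [seq pt R z | z <- zs]].
  rewrite card_fseq undup_id ?(map_inj_uniq (@pt_inj R))//.
  by rewrite size_map size_cat size_map size_iota/=; lia.
have side f : f \in lines -> (forall z, z \in ray m -> 0 < aff f z)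
    /\ (forall z, z \in zs -> aff f z != 0).
  (* A form positive at (50, 0) with nonnegative first coefficient stays positive along the whole
     ray. *)
  have : all (fun f => [&& 0 <= f.1.1, 0 < f.1.1 * 50%Z + f.2 &
      all (fun z => aff f z != 0) base]) lines by vm_compute.
  move=> /allP/[apply] /and3P[u0 c0 /allP base0].
  have ray0 z : z \in ray m -> 0 < aff f z.
    move=> /mapP[j _ ->]; rewrite /aff/= mulr0 addr0 PoszD mulrDr addrAC.
    by rewrite ltr_wpDr// mulr_ge0.
  by split => // z; rewrite mem_cat => /orP[/base0//|/ray0]; rewrite lt0r => /andP[].
pose chi z := pt R z \in Q ord0.
have [//|f [g [fl gl fg]]] := @lines_discrepancy [seq chi z | z <- base].
have [rf zf] := side f fl; have [rg zg] := side g gl.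
have hamE h : hamming [seq chi z | z <- base] (sides h)
    = count (fun z => chi z (+) (0 < aff h z)%R) base.
  by rewrite /hamming zip_map count_map.
rewrite !hamE in fg.
have mf : (t < count (fun z => chi z (+) (0 < aff f z)%R) base
               + count (predC chi) (ray m))%N.
  apply: leq_trans (tolerant_misclassified false QP tQ zf) _.
  rewrite count_cat; apply/eq_leq; congr (_ + _)%N.
    by apply: eq_count => z; rewrite addbF.
  by apply: eq_in_count => z /rf ->; rewrite addbF addbT.
(* Reversing the orientation of [g] exchanges well placed and misplaced points, hence the
   complements. *)
have mg : (t < count (predC (fun z => chi z (+) (0 < aff g z)%R)) base
               + count chi (ray m))%N.
  apply: leq_trans (tolerant_misclassified true QP tQ zg) _.
  rewrite count_cat; apply/eq_leq; congr (_ + _)%N.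
    by apply: eq_count => z; rewrite addbT.
  by apply: eq_in_count => z /rg ->; rewrite !addbT negbK.
(* Adding [mf] and [mg] gives at least 2t + 2, while these counts and [fg] bound the sum by 10 - 4 +
   m = 2t + 1. *)
have := count_predC (fun z => chi z (+) (0 < aff g z)%R) base.
have := count_predC chi (ray m).
rewrite size_map size_iota (_ : size base = 10)//.
by lia.
Qed.

Theorem theorem7 (R : realType) (t : nat) (ht : (3 <= t)%N) :
  (2 * t + 6 <= tolerance_number R 2 2 t)%N.
Proof.
rewrite /tolerance_number; case: pselect => [ex|[]]; last first.
  exists (4 * t.+1)%N; apply/asboolP; split; first by rewrite muln_gt0.
  exact: always_tolerant_radon.
(* A minimum of at most 2t + 5 would, by monotonicity, make 2t + 5 itself sufficient. *)
case: ex_minnP => n /asboolP[_ tol] _; rewrite leqNgt; apply/negP => lt_n.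
by apply: (not_always_tolerant ht); apply: always_tolerant_leq tol; lia.
Qed.
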